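(* Let $k\ge2$ be an integer and let $\mathcal{U}_t^k=(U_t^{(1)},\ldots,U_t^{(k)})^\top$, $t\ge0$, be the iterative Latin hypercube sampling sequence defined by: $U_0^{(1)},\ldots,U_0^{(k)}$ are i.i.d. $\mathrm{Uniform}(0,1)$ and, for $t=0,1,2,\ldots$, $$\mathcal{U}_{t+1}^k=\frac1k\big(\mathcal{K}_t+\mathcal{U}_t^k\big),$$ where $\mathcal{K}_t=(\sigma_t(0),\ldots,\sigma_t(k-1))^\top$ is a uniformly random permutation of $\{0,1,\ldots,k-1\}$, independent of all previous draws. Then for any $t\ge0$ and any $i,j\in\{1,\ldots,k\}$ with $i\neq j$: (i) $U_t^{(i)}\sim\mathrm{Uniform}(0,1)$. (ii) $\mathrm{Corr}(U_t^{(i)},U_t^{(j)})=-\dfrac{1}{k-1}\left(1-\dfrac{1}{k^{2t}}\right)$. (iii) $\{U_{t_1}^{(1)},\ldots,U_{t_k}^{(k)}\}$ are negatively associated (NA) for any finite nonnegative integers $t_1,\ldots,t_k$.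
   Context: Negative association: random variables $\{X_i\}_{1\le i\le n}$ are said to be negatively associated (NA) if for every pair of disjoint finite subsets $A_1,A_2$ of $\{1,\ldots,n\}$ and for any real functions $f_1,f_2$ that are nondecreasing in each of their arguments, $$\mathrm{Cov}\big(f_1(X_i,i\in A_1),f_2(X_j,j\in A_2)\big)\le 0$$ whenever this covariance is well defined. *)

(* Defs.v *)
From HB Require Import structures.
From mathcomp Require Import all_boot all_order all_algebra all_fingroup.
From mathcomp Require Import all_classical all_reals all_analysis.

Set Implicit Arguments.
Unset Strict Implicit.
Unset Printing Implicit Defensive.

Import Order.TTheory GRing.Theory Num.Theory.
Import numFieldNormedType.Exports.

Local Open Scope classical_set_scope.
Local Open Scope ring_scope.

Section basic_notions.
Context d (T : measurableType d) (R : realType) (P : probability T R).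

Definition is_uniform01 (X : {RV P >-> R}) : Prop :=
  forall A : set R, measurable A ->
    distribution P X A = uniform_prob (@ltr01 R) A.

Definition mutually_independent (I : finType) (X : I -> {RV P >-> R}) : Prop :=
  forall (J : {set I}) (B : I -> set R), (forall i, measurable (B i)) ->
    P (\bigcap_(i in [set` J]) X i @^-1` B i)
    = (\prod_(i in J) P (X i @^-1` B i))%E.

(* Meaningful when X and Y are square-integrable and not a.s. constant;
   otherwise the conventions [fine +oo = 0] and [x / 0 = 0] apply. *)
Definition correlation (X Y : T -> R) : R :=
  fine (covariance P X Y)
  / (Num.sqrt (fine 'V_P[X]) * Num.sqrt (fine 'V_P[Y])).

End basic_notions.

Section negative_association.
Context d (T : measurableType d) (R : realType) (P : probability T R).

Definition nondecreasing_in_each_argument (I : Type) (f : (I -> R) -> R) :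
    Prop :=
  forall (i : I) (x y : I -> R),
    (forall j, j <> i -> x j = y j) -> x i <= y i -> f x <= f y.

(* The covariance of Y1 and Y2 is well defined when Y1, Y2 and Y1 * Y2 are
   integrable random variables.  Membership in [Lfun P 1] includes
   measurability of the composites; f1 and f2 themselves are not required to be
   Borel, since a coordinatewise nondecreasing function of several variables
   need not be. *)
Definition negatively_associated (n : nat) (X : 'I_n -> T -> R) : Prop :=
  forall (A1 A2 : {set 'I_n}), [disjoint A1 & A2]%bool ->
  forall (f1 : ({i : 'I_n | i \in A1} -> R) -> R)
         (f2 : ({i : 'I_n | i \in A2} -> R) -> R),
  nondecreasing_in_each_argument f1 ->
  nondecreasing_in_each_argument f2 ->
  let Y1 : T -> R := fun w => f1 (fun i => X (val i) w) in
  let Y2 : T -> R := fun w => f2 (fun i => X (val i) w) in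
  Y1 \in Lfun P 1 -> Y2 \in Lfun P 1 -> (Y1 * Y2)%R \in Lfun P 1 ->
  (covariance P Y1 Y2 <= 0)%E.

End negative_association.

Section iterative_latin_hypercube_sampling.
Context d (T : measurableType d) (R : realType) (P : probability T R).

Definition previous_draws (k : nat) (U0 : 'I_k -> {RV P >-> R})
    (sigma : nat -> T -> 'S_k) (t : nat) : set (set T) :=
  <<s (\bigcup_i preimage_set_system setT (U0 i) measurable)
      `|` (\bigcup_(s in [set s | (s < t)%N])
             preimage_set_system setT (sigma s) setT) >>.

(* U t i is U_t^(i+1): indices run over 'I_k = {0, ..., k-1}.  As a vector,
   K_t has entries sigma_t(0), ..., sigma_t(k-1), and 'S_k carries no
   measurable structure, hence the explicit measurability condition. *)
Record iterative_LHS (k : nat) (U : nat -> 'I_k -> {RV P >-> R})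
    (sigma : nat -> T -> 'S_k) : Prop := {
  lhs_init_uniform : forall i, is_uniform01 (U 0%N i) ;
  lhs_init_independent : mutually_independent (U 0%N) ;
  lhs_perm_measurable : forall t (p : 'S_k),
    measurable (sigma t @^-1` [set p]) ;
  lhs_perm_uniform : forall t (p : 'S_k),
    P (sigma t @^-1` [set p]) = ((k`!%:R)^-1)%:E ;
  lhs_perm_independent : forall t (p : 'S_k) (A : set T),
    previous_draws (U 0%N) sigma t A ->
    P (sigma t @^-1` [set p] `&` A) = (P (sigma t @^-1` [set p]) * P A)%E ;
  lhs_step : forall t i (w : T),
    U t.+1 i w = k%:R^-1 * ((nat_of_ord (sigma t w i))%:R + U t i w)
}.

End iterative_latin_hypercube_sampling.

(* Main.v *)
(* Each point is a coordinatewise nondecreasing function of its own initial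
   value and of its own entries of the permutations drawn so far, so (iii) follows
   from negative association of a random permutation (conditioning on the position
   of its maximum) and from its stability under independent products.  To integrate
   functions that are monotone but possibly not Borel, the initial values are
   rounded to the grid of mesh 1/N: rounding down and up brackets the function, and
   since shifting the grid by one cell moves only its boundary faces, the two
   averages differ by O(1/N).  Integrable functions are then truncated.
   For (i) the tail P(U > x) is computed by induction on time.  For (ii), the
   stationarity of the marginal law turns the one-step recursions for the first two
   moments into equations, and the recursion for E[U^(i) U^(j)] is then solved. *)
Require Import Defs.
From HB Require Import structures.
From mathcomp Require Import all_boot all_order all_algebra all_fingroup.
From mathcomp Require Import all_classical all_reals all_analysis.
From mathcomp Require Import measurable_realfun.
From mathcomp Require Import ring lra.

Set Implicit Arguments.
Unset Strict Implicit.
Unset Printing Implicit Defensive.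

Import Order.TTheory GRing.Theory Num.Theory.
Import numFieldNormedType.Exports.

Local Open Scope classical_set_scope.
Local Open Scope ring_scope.

(** * Negative association on finite uniform probability spaces *)

(** For reflexive preorders, applying the condition in both directions shows that [f] takes the same
    value at points agreeing on [A]. Dependence on the coordinates in [A] alone is thus built in,
    without projecting. *)
Definition monotone_on (n : nat) (R : realType) (F : Type)
    (le : 'I_n -> F -> F -> Prop) (A : {set 'I_n}) (f : F -> R) : Prop :=
  forall x y, (forall i, i \in A -> le i x y) -> f x <= f y.

(* Negative association under the uniform law on F of coordinates that are
   known only through the preorders [le i]. *)
Definition finite_NA (n : nat) (R : realType) (F : finType)
    (le : 'I_n -> F -> F -> Prop) : Prop :=
  forall (A1 A2 : {set 'I_n}) (f1 f2 : F -> R), [disjoint A1 & A2]%bool ->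
    monotone_on le A1 f1 -> monotone_on le A2 f2 ->
    #|F|%:R * \sum_x f1 x * f2 x <= (\sum_x f1 x) * (\sum_x f2 x).

Definition prod_le (n : nat) (F G : Type) (leF : 'I_n -> F -> F -> Prop)
    (leG : 'I_n -> G -> G -> Prop) (i : 'I_n) (x y : F * G) : Prop :=
  leF i x.1 y.1 /\ leG i x.2 y.2.

(** Conditioning on the second factor: negative association on [F] bounds each section, and the
    section sums are again monotone in the second factor, where negative association on [G]
    applies. *)
Lemma finite_NA_prod (n : nat) (R : realType) (F G : finType)
    (leF : 'I_n -> F -> F -> Prop) (leG : 'I_n -> G -> G -> Prop) :
  (forall i x, leF i x x) -> (forall i x, leG i x x) ->
  finite_NA R leF -> finite_NA R leG -> finite_NA R (prod_le leF leG).
Proof.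
move=> rF rG naF naG A1 A2 f1 f2 A12 m1 m2.
have pairE (f : F * G -> R) : \sum_z f z = \sum_y \sum_x f (x, y).
  by rewrite exchange_big pair_big; apply: eq_bigr => -[].
have sec (A : {set 'I_n}) (f : F * G -> R) y :
    monotone_on (prod_le leF leG) A f -> monotone_on leF A (fun x => f (x, y)).
  by move=> mf x x' xx'; apply: mf => i iA; split => //=; exact: xx'.
have marg (A : {set 'I_n}) (f : F * G -> R) :
    monotone_on (prod_le leF leG) A f ->
    monotone_on leG A (fun y => \sum_x f (x, y)).
  move=> mf y y' yy'; apply: ler_sum => x _.
  by apply: mf => i iA; split => //=; exact: yy'.
rewrite !pairE card_prod natrM [#|F|%:R * _]mulrC -mulrA.
apply: le_trans (naG _ _ _ _ A12 (marg _ _ m1) (marg _ _ m2)).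
rewrite ler_wpM2l// mulr_sumr ler_sum// => y _.
exact: naF A12 (sec _ _ _ m1) (sec _ _ _ m2).
Qed.

(** Take two independent copies of the coordinates and exchange those outside [A1]. This is a
    bijection of pairs that turns [f1] and [f2] at the same copy into [f1] and [f2] at different
    copies, so the covariance is in fact zero. *)
Lemma finite_NA_ffun (n : nat) (R : realType) (F : finType) (le : rel F) :
  reflexive le ->
  finite_NA R (fun (i : 'I_n) (x y : {ffun 'I_n -> F}) => le (x i) (y i)).
Proof.
move=> lexx A1 A2 f1 f2 A12 m1 m2.
pose merge (z : {ffun 'I_n -> F} * {ffun 'I_n -> F}) : {ffun 'I_n -> F} :=
  [ffun i => if i \in A1 then z.1 i else z.2 i].
pose swap z := (merge z, merge (z.2, z.1)).
have swapK : involutive swap.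
  case=> x y; rewrite /swap /=; congr (_, _); apply/ffunP => i;
    by rewrite /merge !ffunE /=; case: (i \in A1).
have f1E z : f1 (merge z) = f1 z.1.
  by apply/eqP; rewrite eq_le !m1// => i iA; rewrite ffunE iA.
have f2E z : f2 (merge z) = f2 z.2.
  apply/eqP; rewrite eq_le !m2// => i iA; rewrite ffunE ifF//;
  by rewrite (disjointFl A12 iA).
rewrite [leRHS]big_distrlr [leRHS]pair_big /=.
have -> : \sum_z f1 z.1 * f2 z.2 =
    \sum_(z : {ffun 'I_n -> F} * {ffun 'I_n -> F}) f1 z.1 * f2 z.1.
  rewrite [RHS](reindex_inj (inv_inj swapK)) /=.
  by apply: eq_bigr => z _; rewrite f1E f2E.
rewrite -(pair_big predT predT (fun x y => f1 x * f2 x)) /= mulr_sumr.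
by apply: ler_sum => x _; rewrite sumr_const mulr_natl.
Qed.

(** A permutation amounts to the position [j] of its largest value together with the arrangement [s]
    of the other values; injectivity and a cardinality count give the bijection. *)
Lemma sum_perm_max (V : nmodType) (n : nat) (g : 'S_n.+1 -> V) :
  \sum_p g p = \sum_j \sum_(s : 'S_n) g (lift_perm j ord_max s).
Proof.
rewrite pair_big /=.
pose h (z : 'I_n.+1 * 'S_n) : 'S_n.+1 := lift_perm z.1 ord_max z.2.
have h_inj : injective h.
  move=> [j s] [j' s'] /permP /= hE; have /eqP jj' : j == j'.
    by rewrite -(inj_eq (@perm_inj _ (h (j', s')))) -hE !lift_perm_id.
  subst j'; congr (_, _); apply/permP => i.
  by have := hE (lift j i); rewrite !lift_perm_lift => /lift_inj.
have h_bij : bijective h.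
  by apply: inj_card_bij h_inj _; rewrite card_prod !card_Sn card_ord factS.
by rewrite (reindex h) //; exact: onW_bij.
Qed.


Lemma sum_perm_at_max (V : nmodType) (n : nat) (g : 'S_n.+1 -> V) (j : 'I_n.+1) :
  \sum_(p : 'S_n.+1 | p j == ord_max) g p = \sum_(s : 'S_n) g (lift_perm j ord_max s).
Proof.
rewrite big_mkcond sum_perm_max (bigD1 j) //= [X in _ + X]big1 ?addr0.
  by apply: eq_bigr => s _; rewrite lift_perm_id eqxx.
move=> j' j'j; apply: big1 => s _.
by rewrite -[X in _ == X](lift_perm_id j' ord_max s) (inj_eq perm_inj) eq_sym (negbTE j'j).
Qed.

(** The double sum of [(a i - a j) * (b i - b j)] equals twice the difference of the two sides. *)
Lemma chebyshev_sum_le (R : realType) (I : finType) (a b : I -> R) :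
  (forall i j, (a i - a j) * (b i - b j) <= 0) ->
  #|I|%:R * \sum_i a i * b i <= (\sum_i a i) * (\sum_i b i).
Proof.
move=> ab; have : \sum_i \sum_j (a i - a j) * (b i - b j) <= 0.
  by apply: sumr_le0 => i _; apply: sumr_le0.
set S := \sum_i a i * b i; set A := \sum_i a i; set B := \sum_i b i.
have cstE (c : R) : \sum_(i in I) c = #|I|%:R * c by rewrite sumr_const mulr_natl.
have inner i : \sum_j (a i - a j) * (b i - b j) =
    #|I|%:R * (a i * b i) - a i * B - b i * A + S.
  by rewrite -cstE !mulr_sumr -!sumrB -big_split /=; apply: eq_bigr => j _; ring.
have -> : \sum_i \sum_j (a i - a j) * (b i - b j) = 2 * (#|I|%:R * S - A * B).
  rewrite (eq_bigr _ (fun i _ => inner i)) big_split /= !sumrB.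
  by rewrite -mulr_sumr -!mulr_suml cstE -/S -/A -/B; ring.
by rewrite pmulr_rle0// subr_le0.
Qed.

(* By conditioning on the position [j] of the maximum: the conditional mean of a
   function monotone on [A] is larger for [j] in [A] than for [j] outside. *)
Lemma finite_NA_perm (R : realType) (n : nat) :
  finite_NA R (fun (i : 'I_n) (p q : 'S_n) => (p i <= q i)%N).
Proof.
elim: n => [|n IHn] A1 A2 f1 f2 A12 m1 m2.
  have perm0 (p : 'S_0) : p = 1%g by apply/permP; case.
  have sum0 (f : 'S_0 -> R) : \sum_p f p = f 1%g.
    by rewrite (bigD1 1%g)//= big1 ?addr0// => p; rewrite (perm0 p) eqxx.
  by rewrite !sum0 card_Sn mul1r.
pose top j (f : 'S_n.+1 -> R) (s : 'S_n) := f (lift_perm j ord_max s).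
pose g f j := \sum_s top j f s.
pose lo (A : {set 'I_n.+1}) j : {set 'I_n} := finset (fun i => lift j i \in A).
have top_mono (A : {set 'I_n.+1}) f j :
    monotone_on (fun i (p q : 'S_n.+1) => (p i <= q i)%N) A f ->
    monotone_on (fun i (p q : 'S_n) => (p i <= q i)%N) (lo A j) (top j f).
  move=> mf s s' ss'; apply: mf => i.
  case: (unliftP j i) => [i' ->|-> _]; last by rewrite !lift_perm_id.
  by move=> jiA; rewrite !lift_perm_lift !lift_max ss'// inE.
have g_le (A : {set 'I_n.+1}) f j j' :
    monotone_on (fun i (p q : 'S_n.+1) => (p i <= q i)%N) A f ->
    j' \notin A -> g f j' <= g f j.
  move=> mf j'A; rewrite /g /top -!(sum_perm_at_max f).
  (* Exchanging the values at [j] and [j'] matches the permutations with maximum at [j'] with those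
     with maximum at [j]. Inside [A] only the value at [j] can change, and it is raised to the
     maximum. *)
  rewrite (reindex_inj (mulgI (tperm j j'))) /=.
  under eq_bigl do rewrite permM tpermR.
  apply: ler_sum => p /eqP pj; apply: mf => i iA; rewrite permM.
  case: tpermP => [->|ij'|//]; first by rewrite pj leq_ord.
  by rewrite ij' (negbTE j'A) in iA.
rewrite (sum_perm_max f1) (sum_perm_max f2) (sum_perm_max (fun p => f1 p * f2 p)).
(* The induction hypothesis bounds the covariance given [j]; the sum inequality then handles the
   conditional means, whose differences must have opposite signs. *)
apply: le_trans (@chebyshev_sum_le R _ (g f1) (g f2) _).
  rewrite card_ord card_Sn factS natrM -mulrA ler_wpM2l// mulr_sumr.
  apply: ler_sum => j _; rewrite -(card_Sn n).
  apply: (IHn (lo A1 j) (lo A2 j) (top j f1) (top j f2)); try exact: top_mono.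
  rewrite -setI_eq0; apply/eqP/setP => i; rewrite !inE.
  by apply/negP => /andP[iA1]; rewrite (disjointFr A12 iA1).
(* If [j] and [j'] miss the same set, the conditional means of its function coincide; if they miss
   different sets, the two differences have opposite signs. *)
have notin12 j : j \notin A1 \/ j \notin A2.
  by case: (boolP (j \in A1)) => jA; [right; rewrite (disjointFr A12 jA)|left].
move=> j j'; have le1 := g_le _ _ _ _ m1; have le2 := g_le _ _ _ _ m2.
case: (notin12 j) (notin12 j') => [h|h] [h'|h'].
- by rewrite (@le_anti _ _ (g f1 j) (g f1 j')) ?subrr ?mul0r// !le1.
- by rewrite mulr_le0_ge0 ?subr_le0 ?subr_ge0 ?le1 ?le2.
- by rewrite mulr_ge0_le0 ?subr_le0 ?subr_ge0 ?le1 ?le2.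
- by rewrite (@le_anti _ _ (g f2 j) (g f2 j')) ?subrr ?mulr0// !le2.
Qed.

(** * Discretised sampling histories *)

Fixpoint perm_hist (k m : nat) : finType :=
  if m is m'.+1 then ((perm_hist k m' * 'S_k)%type : finType) else (unit : finType).

Fixpoint hist_le (k m : nat) : 'I_k -> perm_hist k m -> perm_hist k m -> Prop :=
  match m with
  | 0 => fun _ _ _ => True
  | m'.+1 => prod_le (@hist_le k m') (fun i (p q : 'S_k) => (p i <= q i)%N)
  end.

(** The identity is a default for times [s >= m]; a path up to time [t <= m] reads only earlier
    entries. *)
Fixpoint hist_at (k m : nat) : perm_hist k m -> nat -> 'S_k :=
  match m with
  | 0 => fun _ _ => 1%g
  | m'.+1 => fun q s => if s == m' then q.2 else hist_at q.1 s
  end.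

Lemma hist_le_refl (k m : nat) (i : 'I_k) (q : perm_hist k m) : hist_le i q q.
Proof. by elim: m q => //= m IHm q; split. Qed.

Lemma hist_le_at (k m : nat) (i : 'I_k) (q q' : perm_hist k m) (s : nat) :
  hist_le i q q' -> (hist_at q s i <= hist_at q' s i)%N.
Proof. by elim: m q q' => //= m IHm q q' [le1 le2]; case: eqP => _ //; exact: IHm. Qed.

Lemma finite_NA_perm_hist (R : realType) (k m : nat) :
  finite_NA R (@hist_le k m).
Proof.
elim: m => [|m IHm] /=.
  move=> A1 A2 f1 f2 _ _ _; rewrite card_unit mul1r.
  have sum1 (f : unit -> R) : \sum_x f x = f tt.
    by rewrite (bigD1 tt)//= big1 ?addr0// => -[].
  by rewrite !sum1.
apply: finite_NA_prod => //; first exact: hist_le_refl.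
exact: finite_NA_perm.
Qed.

Lemma card_perm_hist (k m : nat) : #|perm_hist k m| = (k`! ^ m)%N.
Proof.
elim: m => [|m IHm] /=; first by rewrite card_unit.
by rewrite card_prod IHm card_Sn expnSr.
Qed.

(** The recursion with the draws as parameters, so that it can be evaluated at a random initial
    value and at a grid point alike. *)
Fixpoint lhs_path (R : realType) (k : nat) (p : nat -> 'S_k) (x : R) (i : 'I_k)
    (t : nat) : R :=
  if t is t'.+1 then k%:R^-1 * ((p t' i)%:R + lhs_path p x i t') else x.

Lemma le_lhs_path (R : realType) (k : nat) (p q : nat -> 'S_k) (x y : R)
    (i : 'I_k) (t : nat) :
  (forall s, (s < t)%N -> (p s i <= q s i)%N) -> x <= y ->
  lhs_path p x i t <= lhs_path q y i t.
Proof.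
elim: t => //= t IHt pq xy; rewrite ler_wpM2l ?invr_ge0// lerD ?ler_nat ?pq//.
by apply: IHt => // s st; rewrite pq// (ltn_trans st).
Qed.

(** All faces orthogonal to direction [i] have the same size, by cyclic translation, and each grid
    point lies on exactly one of the [N.+1] translates. *)
Lemma sum_grid_face (R : realType) (k N : nat) (i : 'I_k) :
  N.+1%:R * \sum_(v : {ffun 'I_k -> 'I_N.+1}) (v i == ord_max)%:R
  = #|{ffun 'I_k -> 'I_N.+1}|%:R :> R.
Proof.
have shiftE (c : 'I_N.+1) : \sum_(v : {ffun 'I_k -> 'I_N.+1}) (v i == ord_max)%:R
    = \sum_(v : {ffun 'I_k -> 'I_N.+1}) (v i + c == ord_max)%:R :> R.
  rewrite (reindex_inj (addIr [ffun=> c])) /=.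
  by apply: eq_bigr => v _; rewrite !ffunE.
set S : R := \sum_v _; have -> : N.+1%:R * S = \sum_(c in 'I_N.+1) S.
  by rewrite sumr_const card_ord mulr_natl.
rewrite /S (eq_bigr _ (fun c _ => shiftE c)) exchange_big /= -sumr_const.
apply: eq_bigr => v _; rewrite (bigD1 (ord_max - v i))//= [v i + _]addrC subrK eqxx.
rewrite big1 ?addr0// => c cE; case: eqP => // vc; case/eqP: cE.
by rewrite -vc addrC addKr.
Qed.

(* The cyclic shift of the grid is a bijection that differs from the true shift
   only on its top faces. *)
Lemma sum_grid_shift_le (R : realType) (k N : nat) (M : R) (h : ('I_k -> nat) -> R) :
  (forall x, 0 <= h x <= M) ->
  N.+1%:R * (\sum_(v : {ffun 'I_k -> 'I_N.+1}) h (fun i => (v i).+1)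
             - \sum_(v : {ffun 'I_k -> 'I_N.+1}) h (fun i => v i))
  <= M * k%:R * #|{ffun 'I_k -> 'I_N.+1}|%:R.
Proof.
move=> hM; have M0 : 0 <= M by have /andP[/le_trans] := hM (fun=> 0%N); exact.
pose rot (v : {ffun 'I_k -> 'I_N.+1}) := [ffun i => ordS (v i)].
have rot_inj : injective rot.
  move=> v w /ffunP vw; apply/ffunP => i.
  by have := vw i; rewrite !ffunE => /ordS_inj.
rewrite [X in _ - X](reindex_inj rot_inj) /= -sumrB.
apply: (@le_trans _ _ (N.+1%:R * \sum_(v : {ffun 'I_k -> 'I_N.+1})
                         M * \sum_i (v i == ord_max)%:R)); last first.
  rewrite -mulr_sumr exchange_big mulrCA mulr_sumr -mulrA ler_wpM2l//.
  by rewrite (eq_bigr _ (fun i _ => sum_grid_face R N i)) sumr_const card_ord mulr_natl.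
rewrite ler_wpM2l// ler_sum// => v _.
(* On a top face the difference is at most [M] and at least one indicator equals 1; elsewhere the
   cyclic and true shifts agree and the difference vanishes. *)
have [/existsP[i vi]|/existsPn vmax] := boolP [exists i, v i == ord_max].
  rewrite (bigD1 i)//= vi mulrDr mulr1 -[leLHS]addr0 lerD//.
    have /andP[_ h1] := hM (fun i => (v i).+1).
    by have /andP[h2 _] := hM (fun i => rot v i); lra.
  by rewrite mulr_ge0// sumr_ge0.
rewrite (_ : (fun i => nat_of_ord (rot v i)) = (fun i => (v i).+1)).
  by rewrite subrr mulr_ge0// sumr_ge0.
apply/funext => i; rewrite ffunE /= modn_small//.
by have := vmax i; rewrite -val_eqE /= => ?; rewrite ltn_neqAle ltnS eqSS leq_ord andbT.
Qed.

(** * Expectations *)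

(** The arguments are raised from [x] to [y] one at a time along an enumeration of [I]. *)
Lemma nondecreasing_in_each_argumentP (R : realType) (I : finType) (f : (I -> R) -> R) :
  nondecreasing_in_each_argument f ->
  forall x y, (forall i, x i <= y i) -> f x <= f y.
Proof.
move=> mf x y xy.
pose z (s : seq I) i := if i \in s then y i else x i.
have fz s : f x <= f (z s).
  elim: s => [|i s IHs]; first by rewrite (_ : z [::] = x).
  apply: le_trans IHs _; apply: (mf i) => [j /eqP ji|].
    by rewrite /z inE (negbTE ji).
  by rewrite /z inE eqxx /=; case: ifP.
rewrite (le_trans (fz (enum I)))// (_ : z (enum I) = y)//.
by apply/funext => i; rewrite /z mem_enum.
Qed.

Lemma uniform_prob01E (R : realType) (A : set R) : measurable A ->
  uniform_prob (@ltr01 R) A = lebesgue_measure (A `&` `[0, 1]).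
Proof.
move=> mA; rewrite /uniform_prob integral_uniform_pdf.
rewrite (eq_integral (cst 1%E)) => [|x].
  by rewrite integral_cst ?mul1e//; exact: measurableI.
by rewrite inE /= in_itv /uniform_pdf => -[_ /= ->]; rewrite subr0 invr1.
Qed.

Lemma probability_bigsetU d (T : measurableType d) (R : realType)
    (P : probability T R) (I : finType) (E : I -> set T) :
  (forall x, measurable (E x)) -> trivIset setT E ->
  (P (\big[setU/set0]_x E x) = \sum_x P (E x))%E.
Proof.
move=> mE tE; have mD : measurable (\big[setU/set0]_x E x).
  exact: bigsetU_measurable.
rewrite -[LHS]mul1e -integral_cst// ge0_integral_bigsetU ?index_enum_uniq//.
- by apply: eq_bigr => x _; rewrite integral_cst// mul1e.
- exact: sub_trivIset tE.
Qed.

(** The cells may fail to cover the space, but their total mass is 1, so what they leave out is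
    negligible. *)
Lemma integral_partition d (T : measurableType d) (R : realType)
    (P : probability T R) (I : finType) (E : I -> set T) (c : R) (Y : T -> R) :
  (forall x, measurable (E x)) -> trivIset setT E ->
  (forall x, P (E x) = c%:E) -> #|I|%:R * c = 1 ->
  measurable_fun setT Y -> (forall w, 0 <= Y w) ->
  (\int[P]_w (Y w)%:E = \sum_(x : I) \int[P]_(w in E x) (Y w)%:E)%E.
Proof.
move=> mE tE PE Ic mY Y0.
pose D := \big[setU/set0]_(x <- index_enum I) E x.
have mD : measurable D by apply: bigsetU_measurable.
have mYT : measurable_fun setT (EFin \o Y) by exact/measurable_EFinP.
have PD : P D = 1%E.
  by rewrite probability_bigsetU// (eq_bigr _ (fun x _ => PE x)) sumEFin sumr_const -mulr_natl Ic.
rewrite (@ge0_negligible_integral _ _ _ _ setT (~` D)) //.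
- rewrite setTD setCK ge0_integral_bigsetU ?index_enum_uniq//.
  + exact: sub_trivIset tE.
  + exact: measurable_funTS.
  + by move=> w _; rewrite lee_fin.
- exact: measurableC.
- by move=> w _; rewrite lee_fin.
- by rewrite [LHS]probability_setC// PD subee.
Qed.

Lemma integral_partition_le d (T : measurableType d) (R : realType)
    (P : probability T R) (I : finType) (E : I -> set T) (c : R) (Y : T -> R)
    (g : I -> R) :
  (forall x, measurable (E x)) -> trivIset setT E ->
  (forall x, P (E x) = c%:E) -> #|I|%:R * c = 1 ->
  measurable_fun setT Y -> (forall w, 0 <= Y w) ->
  (forall x w, E x w -> Y w <= g x) ->
  (\int[P]_w (Y w)%:E <= (c * \sum_x g x)%:E)%E.
Proof.
move=> mE tE PE Ic mY Y0 Yg.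
rewrite (integral_partition mE tE PE)// mulr_sumr -sumEFin.
apply: lee_sum => x _; rewrite mulrC EFinM -(PE x) -integral_cst//.
have [-> |/set0P[w0 xw0]] := eqVneq (E x) set0; first by rewrite !integral_set0.
apply: ge0_le_integral => //.
- by move=> w _; rewrite lee_fin.
- by apply: measurable_funTS; exact/measurable_EFinP.
- by move=> w /Yg; rewrite lee_fin.
Qed.

Lemma integral_partition_ge d (T : measurableType d) (R : realType)
    (P : probability T R) (I : finType) (E : I -> set T) (c : R) (Y : T -> R)
    (g : I -> R) :
  (forall x, measurable (E x)) -> trivIset setT E ->
  (forall x, P (E x) = c%:E) -> #|I|%:R * c = 1 ->
  measurable_fun setT Y -> (forall w, 0 <= Y w) -> (forall x, 0 <= g x) ->
  (forall x w, E x w -> g x <= Y w) ->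
  ((c * \sum_x g x)%:E <= \int[P]_w (Y w)%:E)%E.
Proof.
move=> mE tE PE Ic mY Y0 g0 Yg.
rewrite (integral_partition mE tE PE)// mulr_sumr -sumEFin.
apply: lee_sum => x _; rewrite mulrC EFinM -(PE x) -integral_cst//.
apply: ge0_le_integral => //.
- by move=> w _; rewrite lee_fin.
- by apply: measurable_funTS; exact/measurable_EFinP.
- by move=> w /Yg; rewrite lee_fin.
Qed.

Lemma bounded_Lfun1 d (T : measurableType d) (R : realType) (P : probability T R)
    (Z : T -> R) (M : R) :
  measurable_fun setT Z -> {ae P, forall w, `|Z w| <= M} -> Z \in Lfun P 1.
Proof.
move=> mZ ZM; have mZE : measurable_fun setT (EFin \o Z) by exact/measurable_EFinP.
apply/Lfun1_integrable/integrableP; split=> //.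
apply: (@le_lt_trans _ _ (\int[P]_w (`|M|%:E))%E).
  apply: ae_ge0_le_integral => //.
  - exact: measurableT_comp.
  - by apply: filterS ZM => w Zw _; rewrite lee_fin (le_trans Zw)// ler_norm.
by rewrite integral_cst// [X in (_ * X)%E]probability_setT mule1 ltry.
Qed.

(** Independence identifies the joint law with the product of the marginals on rectangles, hence
    everywhere, and Tonelli separates the factors. The absolute values make the integrand
    nonnegative everywhere, since the variables are so only almost surely. *)
Lemma expectation_mul_indep d (T : measurableType d) (R : realType)
    (P : probability T R) (X0 Y0 : T -> R) :
  measurable_fun setT X0 -> measurable_fun setT Y0 ->
  {ae P, forall w, 0 <= X0 w} -> {ae P, forall w, 0 <= Y0 w} ->
  (forall A B, measurable A -> measurable B ->
    P (X0 @^-1` A `&` Y0 @^-1` B) = (P (X0 @^-1` A) * P (Y0 @^-1` B))%E) ->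
  ('E_P[(X0 * Y0)%R] = 'E_P[X0] * 'E_P[Y0])%E.
Proof.
move=> mX0 mY0; pose X : {RV P >-> R} := mfun_Sub (mem_set mX0).
pose Y : {RV P >-> R} := mfun_Sub (mem_set mY0).
rewrite -[X0]/(X : T -> R) -[Y0]/(Y : T -> R) => X_ge0 Y_ge0 XY.
pose f (z : R * R) : \bar R := (`|z.1| * `|z.2|)%:E.
have mf : measurable_fun setT f.
  by apply/measurable_EFinP/measurable_funM; apply: measurableT_comp.
have f0 z : (0 <= f z)%E by rewrite lee_fin mulr_ge0.
have EE (Z : {RV P >-> R}) : {ae P, forall w, 0 <= Z w} ->
    ('E_P[Z] = \int[distribution P Z]_z `|z|%:E)%E.
  move=> Z0; rewrite unlock ge0_integral_distribution//.
    apply: ae_eq_integral => //.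
    - exact/measurable_EFinP.
    - by apply/measurable_EFinP; exact: measurableT_comp.
    - by apply: filterS Z0 => w Zw _ /=; rewrite ger0_norm.
  by apply/measurable_EFinP; exact: normr_measurable.
have mXY : measurable_fun setT (fun w => (X w, Y w)) by exact: measurable_fun_pair.
transitivity (\int[pushforward P (fun w => (X w, Y w))]_z f z)%E.
  rewrite unlock ge0_integral_pushforward//.
  apply: ae_eq_integral => //.
  - by apply/measurable_EFinP; exact: measurable_funM.
  - exact: measurableT_comp mf mXY.
  - by apply: filterS2 X_ge0 Y_ge0 => w Xw Yw _; rewrite /f /= !ger0_norm.
transitivity (\int[(distribution P X \x distribution P Y)%E]_z f z)%E.
  apply: eq_measure_integral => A mA _; apply/esym.
  apply: (@product_measure_unique _ _ _ _ _ (distribution P X) (distribution P Y)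
    (pushforward P (fun w => (X w, Y w)))) => //.
rewrite fubini_tonelli1// /fubini_F.
rewrite (EE Y Y_ge0) (EE X X_ge0) -ge0_integralZr//=.
- apply: eq_integral => x _; rewrite -ge0_integralZl//=.
  by apply/measurable_EFinP; exact: normr_measurable.
- by apply/measurable_EFinP; exact: normr_measurable.
- by apply: integral_ge0.
Qed.

(** * Events of the sampling history *)

Section sampling_events.
Context d (T : measurableType d) (R : realType) (P : probability T R).
Variables (k : nat) (U : nat -> 'I_k -> {RV P >-> R}) (sigma : nat -> T -> 'S_k).
Hypothesis hU : iterative_LHS U sigma.

Let draws := previous_draws (U 0%N) sigma.

Lemma sigma_algebra_draws t : sigma_algebra setT (draws t).
Proof. exact: smallest_sigma_algebra. Qed.

Lemma drawsI t A B : draws t A -> draws t B -> draws t (A `&` B).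
Proof. exact: (@measurableI _ (g_sigma_algebraType _)). Qed.

Lemma draws_bigcup (I : finType) t (A : I -> set T) :
  (forall i, draws t (A i)) -> draws t (\bigcup_i A i).
Proof.
by move=> mA; apply: (@fin_bigcup_measurable _ (g_sigma_algebraType _)) => // i _;
  exact: mA.
Qed.

Lemma draws_bigcap (I : finType) t (D : set I) (A : I -> set T) :
  (forall i, draws t (A i)) -> draws t (\bigcap_(i in D) A i).
Proof.
by move=> mA; apply: (@fin_bigcap_measurable _ (g_sigma_algebraType _)) => // i _;
  exact: mA.
Qed.

Lemma draws_init t i (B : set R) : measurable B -> draws t (U 0%N i @^-1` B).
Proof.
move=> mB; apply: sub_sigma_algebra; left; exists i => //.
by exists B => //; rewrite setTI.
Qed.

Lemma draws_perm s t (B : set 'S_k) : (s < t)%N -> draws t (sigma s @^-1` B).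
Proof.
move=> st; apply: sub_sigma_algebra; right; exists s => //.
by exists B => //; rewrite setTI.
Qed.

Lemma draws_mono s t : (s <= t)%N -> draws s `<=` draws t.
Proof.
move=> st; apply: smallest_sub; first exact: sigma_algebra_draws.
move=> A [|[r /= rs]] mA; apply: sub_sigma_algebra; first by left.
by right; exists r => //=; exact: leq_trans rs st.
Qed.

(** Only events for single permutations are assumed measurable; every set of permutations is a
    finite union of singletons. *)
Lemma measurable_perm t (B : set 'S_k) : measurable (sigma t @^-1` B).
Proof.
rewrite (_ : _ @^-1` _ = \bigcup_(p in B) (sigma t @^-1` [set p])).
  apply: fin_bigcup_measurable => [|p _]; first exact: finite_finset.
  exact: (lhs_perm_measurable hU).
by apply/seteqP; split => [w wB|w [p pB /= ->]] //; exists (sigma t w).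
Qed.

Lemma draws_measurable t : draws t `<=` measurable.
Proof.
apply: smallest_sub; first exact: sigma_algebra_measurable.
move=> A [[i _ [B mB <-]]|[s _ [B _ <-]]]; first exact: measurable_funP.
by rewrite setTI; exact: measurable_perm.
Qed.

(** This makes the independence of [sigma t] from the previous draws applicable to events about
    [U t i]. The induction splits according to the finitely many values of the last permutation. *)
Lemma draws_path t i (B : set R) : measurable B -> draws t (U t i @^-1` B).
Proof.
elim: t B => [|t IHt] B mB; first exact: draws_init.
pose step (p : 'S_k) (x : R) := k%:R^-1 * ((p i)%:R + x).
rewrite (_ : _ @^-1` _ =
    \bigcup_p (sigma t @^-1` [set p] `&` U t i @^-1` (step p @^-1` B))).
  apply: draws_bigcup => p; apply: drawsI; first exact: draws_perm.
  apply: (draws_mono (leqnSn t)); apply: IHt.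
  rewrite -[_ @^-1` _]setTI.
  suff mstep : measurable_fun setT (step p) by exact: mstep.
  by apply: measurable_funM => //; exact: measurable_funD.
apply/seteqP; split => w /=; rewrite (lhs_step hU).
  by exists (sigma t w).
by case=> p _ [<-].
Qed.

Fixpoint hist_event (m : nat) : perm_hist k m -> set T :=
  match m with
  | 0 => fun _ => setT
  | m'.+1 => fun q => sigma m' @^-1` [set q.2] `&` hist_event q.1
  end.

Lemma hist_eventP m (q : perm_hist k m) w :
  hist_event q w -> forall s, (s < m)%N -> sigma s w = hist_at q s.
Proof.
elim: m q => //= m IHm q [mq wq] s sm; case: eqP => [->//|/eqP sm'].
by apply: IHm => //; rewrite ltn_neqAle sm' -ltnS.
Qed.

Lemma hist_event_inj m (q q' : perm_hist k m) w :
  hist_event q w -> hist_event q' w -> q = q'.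
Proof.
elim: m q q' => [|m IHm] /=; first by move=> [] [].
by move=> [q p] [q' p'] /= [<- wq] [<- wq']; rewrite (IHm q q').
Qed.

Lemma draws_hist_event m (q : perm_hist k m) : draws m (hist_event q).
Proof.
elim: m q => [|m IHm] q /=.
  exact: (@measurableT _ (g_sigma_algebraType _)).
apply: drawsI; first exact: draws_perm.
exact: (draws_mono (leqnSn m)).
Qed.

(** The latest permutation is independent of [A] and of all earlier ones, so each time step
    contributes a factor [1 / k!]. *)
Lemma probability_hist_event m (q : perm_hist k m) (A : set T) : draws 0 A ->
  P (A `&` hist_event q) = (P A * ((k`!%:R ^- m)%:E))%E.
Proof.
move=> dA; elim: m q => [|m IHm] q /=; first by rewrite setIT expr0 invr1 mule1.
rewrite setICA (lhs_perm_independent hU); last first.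
  by apply: drawsI; [exact: (draws_mono (leq0n m))|exact: draws_hist_event].
by rewrite (lhs_perm_uniform hU) IHm muleCA -EFinM exprS invfM.
Qed.

(** Half-open cells are pairwise disjoint; the intersection over the full finite set has the shape
    used in [mutually_independent]. *)
Definition grid_event (N : nat) (v : {ffun 'I_k -> 'I_N.+1}) : set T :=
  \bigcap_(i in [set` [set: 'I_k]%SET])
    U 0%N i @^-1` `[(v i)%:R / N.+1%:R, (v i).+1%:R / N.+1%:R[.

Lemma draws_grid_event N (v : {ffun 'I_k -> 'I_N.+1}) : draws 0 (grid_event v).
Proof. by apply: draws_bigcap => i; exact: draws_init. Qed.

Lemma grid_event_inj N (v v' : {ffun 'I_k -> 'I_N.+1}) w :
  grid_event v w -> grid_event v' w -> v = v'.
Proof.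
move=> vw v'w; apply/ffunP => i; apply/val_inj/eqP; rewrite eqn_leq.
have := v'w i; have := vw i; rewrite /= !in_itv /= !inE.
move=> /(_ isT)/andP[a1 a2] /(_ isT)/andP[b1 b2].
have := le_lt_trans a1 b2; have := le_lt_trans b1 a2.
by rewrite !ltr_pM2r ?invr_gt0// !ltr_nat !ltnS => -> ->.
Qed.

Lemma probability_grid_event N (v : {ffun 'I_k -> 'I_N.+1}) :
  P (grid_event v) = (N.+1%:R ^- k)%:E.
Proof.
rewrite /grid_event (lhs_init_independent hU)//.
rewrite (eq_bigr (fun=> (N.+1%:R^-1 : R)%:E)) => [|i _].
  by rewrite prodEFin prodr_const cardsT card_ord exprVn.
transitivity (uniform_prob (@ltr01 R) `[(v i)%:R / N.+1%:R, (v i).+1%:R / N.+1%:R[).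
  exact: (lhs_init_uniform hU).
rewrite uniform_prob01E// setIidl.
  rewrite lebesgue_measure_itv /= lte_fin ltr_pM2r ?invr_gt0// ltr_nat ltnSn.
  by rewrite -EFinB -mulrBl -natrB ?leqnSn// subSnn mul1r.
move=> x /=; rewrite !in_itv /= => /andP[x1 x2].
rewrite (le_trans _ x1) ?divr_ge0//=; apply/ltW/(lt_le_trans x2).
by rewrite ler_pdivrMr// mul1r ler_nat.
Qed.

Lemma lhs_pathE m (q : perm_hist k m) w t i : (t <= m)%N -> hist_event q w ->
  U t i w = lhs_path (hist_at q) (U 0%N i w) i t.
Proof.
move=> + qw; elim: t => //= t IHt tm; rewrite (lhs_step hU) IHt 1?ltnW//.
by rewrite (hist_eventP qw).
Qed.

End sampling_events.

(** * Negative association of the sampled points *)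

Lemma ler_add_natP (R : realType) (a b D : R) :
  (forall N : nat, a <= b + D / N.+1%:R) -> a <= b.
Proof.
move=> h; rewrite leNgt; apply/negP => ba.
have ab : 0 < a - b by rewrite subr_gt0.
have := h (Num.truncn (D / (a - b))); rewrite leNgt => /negP; apply.
by rewrite -ltrBrDl ltr_pdivrMr// mulrC -ltr_pdivrMr// truncnS_gt.
Qed.

(** The values [b = 0] and [b = 1] stand for the lower and upper corners of a cell. For a fixed
    history the corners differ by the grid shift, whose effect is already bounded; averaging over
    histories keeps the bound. *)
Lemma sum_grid_path_le (R : realType) (k m N : nat) (t : 'I_k -> nat) (M : R)
    (g : ('I_k -> R) -> R) (c : R) :
  (forall x, 0 <= g x <= M) ->
  let path (b : nat) (x : {ffun 'I_k -> 'I_N.+1} * perm_hist k m) (i : 'I_k) : R :=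
    lhs_path (hist_at x.2) ((x.1 i + b)%:R / N.+1%:R) i (t i) in
  #|{: {ffun 'I_k -> 'I_N.+1} * perm_hist k m}|%:R * c = 1 -> 0 <= c ->
  c * \sum_x g (path 1%N x) <= c * \sum_x g (path 0%N x) + M * k%:R / N.+1%:R.
Proof.
move=> gM path Fc c0.
have pairE (f : {ffun 'I_k -> 'I_N.+1} * perm_hist k m -> R) :
    \sum_x f x = \sum_q \sum_v f (v, q).
  by rewrite exchange_big pair_big; apply: eq_bigr => -[].
have gap : N.+1%:R * (\sum_x g (path 1%N x) - \sum_x g (path 0%N x))
    <= M * k%:R * #|{: {ffun 'I_k -> 'I_N.+1} * perm_hist k m}|%:R.
  rewrite card_prod natrM !pairE -sumrB mulr_sumr mulrA mulr_natr -sumr_const.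
  apply: ler_sum => q _.
  pose h (n : 'I_k -> nat) :=
    g (fun i => lhs_path (hist_at q) ((n i)%:R / N.+1%:R) i (t i)).
  have := @sum_grid_shift_le R k N M h (fun n => gM _).
  congr (_ * (_ - _) <= _); apply: eq_bigr => v _; rewrite /h /path; congr g;
    by apply/funext => i; rewrite ?addn1 ?addn0.
have -> : M * k%:R = c * (M * k%:R * #|{: {ffun 'I_k -> 'I_N.+1} * perm_hist k m}|%:R).
  by rewrite [RHS]mulrC -[RHS]mulrA Fc mulr1.
by rewrite -lerBlDl -mulrBr ler_pdivlMr// -[leLHS]mulrA ler_wpM2l// [leLHS]mulrC.
Qed.

Section sampling_NA.
Context d (T : measurableType d) (R : realType) (P : probability T R).
Variables (k : nat) (U : nat -> 'I_k -> {RV P >-> R}) (sigma : nat -> T -> 'S_k).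
Hypothesis hU : iterative_LHS U sigma.

(** The product is bounded by its values at upper corners, finite negative association splits their
    average, and each factor returns to its integral up to [D / N.+1%:R]. Only the composites [Y1]
    and [Y2] are ever integrated. *)
Lemma expectation_mul_le_bounded (t : 'I_k -> nat) (A1 A2 : {set 'I_k})
    (g1 g2 : ('I_k -> R) -> R) (M : R) :
  [disjoint A1 & A2]%bool ->
  (forall x y, (forall i, i \in A1 -> x i <= y i) -> g1 x <= g1 y) ->
  (forall x y, (forall i, i \in A2 -> x i <= y i) -> g2 x <= g2 y) ->
  (forall x, 0 <= g1 x <= M) -> (forall x, 0 <= g2 x <= M) ->
  let Y1 w := g1 (fun i => U (t i) i w) in
  let Y2 w := g2 (fun i => U (t i) i w) in
  measurable_fun setT Y1 -> measurable_fun setT Y2 ->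
  (\int[P]_w (Y1 w * Y2 w)%:E <= \int[P]_w (Y1 w)%:E * \int[P]_w (Y2 w)%:E)%E.
Proof.
move=> A12 m1 m2 b1 b2 Y1 Y2 mY1 mY2.
have M0 : 0 <= M by have /andP[/le_trans] := b1 (fun=> 0); exact.
have Y1_0 w : 0 <= Y1 w by have /andP[] := b1 (fun i => U (t i) i w).
have Y2_0 w : 0 <= Y2 w by have /andP[] := b2 (fun i => U (t i) i w).
have fin (g : ('I_k -> R) -> R) : (forall x, 0 <= g x <= M) ->
    measurable_fun setT (fun w => g (fun i => U (t i) i w)) ->
    (\int[P]_w (g (fun i => U (t i) i w))%:E)%E \is a fin_num.
  move=> gM mg; have gLfun1 : (fun w => g (fun i => U (t i) i w)) \in Lfun P 1.
    apply: (bounded_Lfun1 (M := M) mg); apply: aeW => w.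
    by have /andP[? ?] := gM (fun i => U (t i) i w); rewrite ger0_norm.
  by have := expectation_fin_num gLfun1; rewrite unlock.
have := fin g1 b1 mY1; have := fin g2 b2 mY2; rewrite -/Y1 -/Y2.
set I1 := (\int[P]_w (Y1 w)%:E)%E; set I2 := (\int[P]_w (Y2 w)%:E)%E.
have I1_0 : (0 <= I1)%E by apply: integral_ge0 => w _; rewrite lee_fin.
have I2_0 : (0 <= I2)%E by apply: integral_ge0 => w _; rewrite lee_fin.
move=> /fineK I2E /fineK I1E; rewrite -I1E -I2E -EFinM.
have {}I1_0 : 0 <= fine I1 by rewrite fine_ge0.
have {}I2_0 : 0 <= fine I2 by rewrite fine_ge0.
set y1 := fine I1 in I1E I1_0 *; set y2 := fine I2 in I2E I2_0 *.
pose D := M * k%:R.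
have D0 : 0 <= D by rewrite mulr_ge0.
have bound (N : nat) : (\int[P]_w (Y1 w * Y2 w)%:E
    <= ((y1 + D / N.+1%:R) * (y2 + D / N.+1%:R))%:E)%E.
  (* One history long enough for all the times [t i]. *)
  pose m := \max_i t i.
  pose F : finType := ({ffun 'I_k -> 'I_N.+1} * perm_hist k m)%type.
  pose c : R := N.+1%:R ^- k * k`!%:R ^- m.
  pose E (x : F) := grid_event U x.1 `&` hist_event sigma x.2.
  have c0 : 0 <= c by rewrite mulr_ge0// invr_ge0 exprn_ge0.
  have Fc : #|F|%:R * c = 1.
    rewrite card_prod card_ffun !card_ord card_perm_hist natrM !natrX.
    by rewrite mulrACA !divff ?mulr1// expf_neq0// pnatr_eq0 -lt0n fact_gt0.
  have mE x : measurable (E x).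
    apply: measurableI; apply: (draws_measurable hU).
      exact: draws_grid_event.
    exact: draws_hist_event.
  have tE : trivIset setT E.
    move=> [v q] [v' q'] _ _ [w [[/= wv wq] [wv' wq']]].
    by rewrite (grid_event_inj wv wv') (hist_event_inj wq wq').
  have PE x : P (E x) = c%:E.
    rewrite (probability_hist_event hU); last exact: draws_grid_event.
    by rewrite (probability_grid_event hU).
  clearbody c.
  pose path (b : nat) (x : F) (i : 'I_k) :=
    lhs_path (hist_at x.2) ((x.1 i + b)%:R / N.+1%:R) i (t i) : R.
  have UE (x : F) w i : E x w -> path 0%N x i <= U (t i) i w <= path 1%N x i.
    move=> [wv wq]; rewrite (lhs_pathE hU _ _ wq); last exact: leq_bigmax.
    have := wv i; rewrite /= in_itv /= inE => /(_ isT)/andP[l1 l2].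
    by rewrite !le_lhs_path// ?addn0 ?addn1// ltW.
  have path_mono (A : {set 'I_k}) (g : ('I_k -> R) -> R) b :
      (forall x y, (forall i, i \in A -> x i <= y i) -> g x <= g y) ->
      monotone_on (prod_le (fun i (v v' : {ffun 'I_k -> 'I_N.+1}) => (v i <= v' i)%N)
        (@hist_le k m)) A (g \o path b).
    move=> mg x y xy; apply: mg => i /xy[le1 le2]; apply: le_lhs_path.
      by move=> s _; exact: hist_le_at.
    by rewrite ler_pM2r ?invr_gt0// ler_nat leq_add2r.
  have NA : @finite_NA k R F (prod_le
        (fun i (v v' : {ffun 'I_k -> 'I_N.+1}) => (v i <= v' i)%N)
        (@hist_le k m)).
    apply: finite_NA_prod => //.
    - exact: hist_le_refl.
    - by apply: (@finite_NA_ffun _ _ _ (fun a b : 'I_N.+1 => (a <= b)%N)) => a.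
    - exact: finite_NA_perm_hist.
  (* The upper average exceeds the lower one by at most [D / N.+1%:R], and the lower one is at most
     the integral. *)
  have gap (A : {set 'I_k}) (g : ('I_k -> R) -> R) :
      (forall x y, (forall i, i \in A -> x i <= y i) -> g x <= g y) ->
      (forall x, 0 <= g x <= M) ->
      measurable_fun setT (fun w => g (fun i => U (t i) i w)) ->
      ((c * \sum_x g (path 1%N x))%:E
       <= \int[P]_w (g (fun i => U (t i) i w))%:E + (D / N.+1%:R)%:E)%E.
    move=> mg gM mY; apply: (@le_trans _ _ (c * \sum_x g (path 0%N x) + D / N.+1%:R)%:E).
      by rewrite lee_fin; exact: sum_grid_path_le gM Fc c0.
    rewrite EFinD leeD2r//; apply: (integral_partition_ge mE tE PE Fc) => //.
    - by move=> w; have /andP[] := gM (fun i => U (t i) i w).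
    - by move=> x; have /andP[] := gM (path 0%N x).
    - by move=> x w xw; apply: mg => i _; have /andP[] := UE x w i xw.
  have g1_ge0 x : 0 <= g1 x by have /andP[] := b1 x.
  have g2_ge0 x : 0 <= g2 x by have /andP[] := b2 x.
  have := gap A1 g1 m1 b1 mY1; rewrite -/Y1 -/I1 -I1E -EFinD lee_fin => gap1.
  have := gap A2 g2 m2 b2 mY2; rewrite -/Y2 -/I2 -I2E -EFinD lee_fin => gap2.
  apply: (@le_trans _ _ (c * \sum_x g1 (path 1%N x) * g2 (path 1%N x))%:E).
    apply: (integral_partition_le mE tE PE Fc).
    - exact: measurable_funM.
    - by move=> w; exact: mulr_ge0.
    - move=> x w xw; apply: ler_pM => //; [apply: m1|apply: m2] => i _;
      by have /andP[] := UE x w i xw.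
  rewrite lee_fin; apply: le_trans (ler_pM _ _ gap1 gap2);
    rewrite ?mulr_ge0// ?sumr_ge0//.
  (* Multiplying by [c * c] turns sums into averages, because [#|F|%:R * c = 1]. *)
  have := NA A1 A2 _ _ A12 (path_mono A1 g1 1%N m1) (path_mono A2 g2 1%N m2).
  move=> /(ler_wpM2l (mulr_ge0 c0 c0)).
  by rewrite [X in X <= _ -> _]mulrCA !mulrA Fc mul1r -!mulrA [X in _ <= c * X]mulrCA.
have : (\int[P]_w (Y1 w * Y2 w)%:E)%E \is a fin_num.
  rewrite ge0_fin_numE; first exact: le_lt_trans (bound 0%N) (ltry _).
  by apply: integral_ge0 => w _; rewrite lee_fin mulr_ge0.
move=> /fineK IE; move: bound; rewrite -IE => bound.
(* The error is [D / n * (y1 + y2 + D / n)] with [n = N.+1%:R]; bounding the inner [D / n] by [D]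
   gives this constant. *)
rewrite lee_fin; apply: (@ler_add_natP _ _ _ (D * (y1 + y2 + D))) => N.
have := bound N; rewrite lee_fin => /le_trans; apply.
have := @ltr0Sn R N.
set n := N.+1%:R => n0.
have n1 : 1 <= n by rewrite ler1n.
have Dn : D / n <= D by rewrite ler_pdivrMr// ler_peMr.
rewrite -subr_ge0 (_ : _ - _ = D / n * (D - D / n)); last by field; rewrite gt_eqF.
by rewrite mulr_ge0 ?subr_ge0// divr_ge0// ltW.
Qed.

End sampling_NA.

(** * Truncation and passage to integrable functions *)

Definition truncation (R : realType) (n : nat) (y : R) : R :=
  Num.max (- n%:R) (Num.min n%:R y).

Lemma truncation_homo (R : realType) (n : nat) :
  {homo @truncation R n : x y / x <= y}.
Proof. by move=> x y xy; rewrite le_max2// le_min2. Qed.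

Lemma normr_truncation_le (R : realType) (n : nat) (y : R) :
  `|truncation n y| <= n%:R.
Proof.
rewrite /truncation; have := ler0n R n; set c := n%:R => c0.
rewrite ler_norml; case: (leP c y) => cy;
  [case: (leP (- c) c)|case: (leP (- c) y)] => ?; by apply/andP; split; lra.
Qed.

Lemma normr_truncation_le_id (R : realType) (n : nat) (y : R) :
  `|truncation n y| <= `|y|.
Proof.
rewrite /truncation; have := ler0n R n; set c := n%:R => c0.
rewrite ler_norml; have := ler_norm y; have := ler_norm (- y); rewrite normrN.
case: (leP c y) => cy; [case: (leP (- c) c)|case: (leP (- c) y)] => ? ? ?;
  by apply/andP; split; lra.
Qed.

Lemma truncation_id (R : realType) (n : nat) (y : R) :
  `|y| <= n%:R -> truncation n y = y.
Proof.
by rewrite ler_norml => /andP[h1 h2]; rewrite /truncation min_r// max_r.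
Qed.

Lemma measurable_truncation d (T : measurableType d) (R : realType) (Y : T -> R)
    (n : nat) :
  measurable_fun setT Y -> measurable_fun setT (fun w => truncation n (Y w)).
Proof. by move=> mY; apply: measurable_maxr => //; exact: measurable_minr. Qed.

Section sampling_NA_unbounded.
Context d (T : measurableType d) (R : realType) (P : probability T R).
Variables (k : nat) (U : nat -> 'I_k -> {RV P >-> R}) (sigma : nat -> T -> 'S_k).
Hypothesis hU : iterative_LHS U sigma.

(** Adding [M] to both functions makes them nonnegative and leaves their covariance unchanged. *)
Lemma expectation_mul_le_norm_bounded (t : 'I_k -> nat) (A1 A2 : {set 'I_k})
    (g1 g2 : ('I_k -> R) -> R) (M : R) :
  [disjoint A1 & A2]%bool ->
  (forall x y, (forall i, i \in A1 -> x i <= y i) -> g1 x <= g1 y) ->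
  (forall x y, (forall i, i \in A2 -> x i <= y i) -> g2 x <= g2 y) ->
  (forall x, `|g1 x| <= M) -> (forall x, `|g2 x| <= M) ->
  let Y1 : T -> R := fun w => g1 (fun i => U (t i) i w) in
  let Y2 : T -> R := fun w => g2 (fun i => U (t i) i w) in
  measurable_fun setT Y1 -> measurable_fun setT Y2 ->
  ('E_P[(Y1 * Y2)%R] <= 'E_P[Y1] * 'E_P[Y2])%E.
Proof.
move=> A12 m1 m2 b1 b2 Y1 Y2 mY1 mY2.
have LY1 : Y1 \in Lfun P 1 by exact: bounded_Lfun1 (aeW _ (fun w => b1 _)).
have LY2 : Y2 \in Lfun P 1 by exact: bounded_Lfun1 (aeW _ (fun w => b2 _)).
have LY12 : (Y1 * Y2)%R \in Lfun P 1.
  apply: (@bounded_Lfun1 _ _ _ _ _ (M * M)); first exact: measurable_funM.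
  by apply: aeW => w; rewrite normrM ler_pM//; [exact: b1|exact: b2].
have LM : cst M \in Lfun P 1 by exact: Lfun_cst.
have shift (g : ('I_k -> R) -> R) : (forall x, `|g x| <= M) ->
    forall x, 0 <= g x + M <= M + M.
  by move=> gM x; have := gM x; rewrite ler_norml => /andP[? ?]; apply/andP; split; lra.
have := @expectation_mul_le_bounded _ _ _ _ _ _ _ hU t A1 A2
  (fun x => g1 x + M) (fun x => g2 x + M) (M + M) A12.
move=> /(_ (fun x y xy => lerD (m1 x y xy) (lexx M))).
move=> /(_ (fun x y xy => lerD (m2 x y xy) (lexx M)) (shift _ b1) (shift _ b2)).
move=> /(_ (measurable_funD mY1 (measurable_cst _)) (measurable_funD mY2 (measurable_cst _))).
have intE (Z : T -> R) : (\int[P]_w (Z w)%:E = 'E_P[Z])%E by rewrite unlock.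
rewrite !intE.
rewrite (_ : (fun w => (g1 _ + M) * (g2 _ + M)) =
    ((Y1 * Y2)%R \+ ((M \o* Y1) \+ ((M \o* Y2) \+ cst (M * M))))); last first.
  apply/funext => w; transitivity (Y1 w * Y2 w + (Y1 w * M + (Y2 w * M + M * M))) => //.
  by rewrite /Y1 /Y2; ring.
rewrite -[fun w => g1 _ + M]/(Y1 \+ cst M) -[fun w => g2 _ + M]/(Y2 \+ cst M).
have Lc : cst (M * M) \in Lfun P 1 by exact: Lfun_cst.
have LMY1 : (M \o* Y1) \in Lfun P 1 by exact: Lfun_scale.
have LMY2 : (M \o* Y2) \in Lfun P 1 by exact: Lfun_scale.
rewrite !expectationD ?rpredD//= !expectationZl// !expectation_cst.
rewrite -(fineK (expectation_fin_num LY1)) -(fineK (expectation_fin_num LY2)).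
rewrite -(fineK (expectation_fin_num LY12)).
rewrite -!(EFinM, EFinD) !lee_fin; nra.
Qed.

(** Truncation preserves monotonicity, so the bounded case applies at each level [n]. Since
    truncation never increases absolute values, [Y1], [Y2] and [Y1 * Y2] dominate, and the
    inequality passes to the limit. *)
Lemma lhs_negatively_associated (t : 'I_k -> nat) :
  negatively_associated P (fun i : 'I_k => U (t i) i).
Proof.
move=> A1 A2 A12 f1 f2 mf1 mf2 Y1 Y2 LY1 LY2 LY12.
rewrite covarianceE// lee_subel_addr ?fin_numM ?expectation_fin_num// add0e.
have mY (Y : T -> R) : Y \in Lfun P 1 -> measurable_fun setT Y.
  by rewrite inE => /andP[/[!inE]].
have mono (A : {set 'I_k}) (f : ({i | i \in A} -> R) -> R) n :
    nondecreasing_in_each_argument f ->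
    forall x y : 'I_k -> R, (forall i, i \in A -> x i <= y i) ->
    truncation n (f (fun i => x (val i))) <= truncation n (f (fun i => y (val i))).
  move=> mf x y xy; apply: truncation_homo.
  by apply: (nondecreasing_in_each_argumentP mf) => i; apply: xy; exact: valP.
have bound n : ('E_P[(fun w => truncation n (Y1 w) * truncation n (Y2 w))%R] <=
    'E_P[(fun w => truncation n (Y1 w))] * 'E_P[(fun w => truncation n (Y2 w))])%E.
  apply: (@expectation_mul_le_norm_bounded t A1 A2
    (fun x => truncation n (f1 (fun i => x (val i))))
    (fun x => truncation n (f2 (fun i => x (val i)))) n%:R) => //.
  - exact: mono.
  - exact: mono.
  - by move=> x; exact: normr_truncation_le.
  - by move=> x; exact: normr_truncation_le.
  - by apply: measurable_truncation; exact: mY.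
  - by apply: measurable_truncation; exact: mY.
have truncE y : truncation n y @[n --> \oo] --> (y : R).
  apply: cvg_near_cst; near=> n; apply: truncation_id.
  near: n; exact: nbhs_infty_ger.
have cvgE (Z_ : nat -> T -> R) (Z : T -> R) : Z \in Lfun P 1 ->
    (forall n, measurable_fun setT (Z_ n)) ->
    (forall w, Z_ n w @[n --> \oo] --> Z w) ->
    (forall n w, `|Z_ n w| <= `|Z w|) ->
    ('E_P[Z_ n] @[n --> \oo] --> 'E_P[Z])%E.
  move=> LZ mZ_ Z_Z ZZ; rewrite unlock.
  have [|||||_ _ +] := @dominated_convergence _ _ _ P setT measurableT
    (fun n => EFin \o Z_ n) (EFin \o Z) (abse \o (EFin \o Z)).
  - by move=> n; exact/measurable_EFinP.
  - by apply/measurable_EFinP; exact: mY.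
  - by apply: aeW => w _; apply: cvg_EFin; [exact: nearW|exact: Z_Z].
  - by apply: integrable_abse; exact/Lfun1_integrable.
  - by apply: aeW => w n _; rewrite lee_fin.
  exact.
have cvg1 (Y : T -> R) : Y \in Lfun P 1 ->
    ('E_P[(fun w => truncation n (Y w))] @[n --> \oo] --> 'E_P[Y])%E.
  move=> LY; apply: cvgE => //.
  - by move=> n; apply: measurable_truncation; exact: mY.
  - by move=> n w; exact: normr_truncation_le_id.
have cvg12 : ('E_P[(fun w => truncation n (Y1 w) * truncation n (Y2 w))%R] @[n --> \oo]
    --> 'E_P[(Y1 * Y2)%R])%E.
  apply: cvgE => //.
  - by move=> n; apply: measurable_funM; apply: measurable_truncation; exact: mY.
  - by move=> w; apply: cvgM; exact: truncE.
  - by move=> n w; rewrite !normrM ler_pM ?normr_truncation_le_id.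
apply: (lee_cvg_to cvg12 (cvgeM _ (cvg1 _ LY1) (cvg1 _ LY2))); last exact: nearW.
by rewrite mule_def_fin// expectation_fin_num.
Unshelve. all: by end_near.
Qed.
End sampling_NA_unbounded.

(** * Uniform marginals *)

(** [clip 1 (1 - x)] is the mass that the uniform law gives to values above [x]. *)
Definition clip (R : realType) (n : nat) (y : R) : R :=
  Num.max 0 (Num.min n%:R y).

Lemma clip_le0 (R : realType) (n : nat) (y : R) : y <= 0 -> clip n y = 0.
Proof. by move=> y0; rewrite /clip max_l// ge_min y0 orbT. Qed.

Lemma clip_id (R : realType) (n : nat) (y : R) : 0 <= y <= n%:R -> clip n y = y.
Proof. by case/andP=> y0 yn; rewrite /clip min_r// max_r. Qed.

Lemma clip_ge (R : realType) (n : nat) (y : R) : n%:R <= y -> clip n y = n%:R.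
Proof. by move=> yn; rewrite /clip min_l// max_r. Qed.

(** With [z = n%:R - y], the summand is the length of the part of [[i, i + 1]] below [z], where
    [i = n - 1 - j]; these parts fill the part of [[0, n]] below [z]. *)
Lemma sum_clip (R : realType) (n : nat) (y : R) :
  \sum_(j < n) clip 1 (1 - y + j%:R) = clip n (n%:R - y).
Proof.
elim: n => [|n IHn]; first by rewrite big_ord0 /clip max_l// ge_min lexx.
rewrite big_ord_recr /= IHn; have := ler0n R n.
have -> : n.+1%:R - y = n%:R - y + 1 by rewrite mulrSr; ring.
have -> : 1 - y + n%:R = n%:R - y + 1 by ring.
set z := n%:R - y => n0.
have [zn|zn] := lerP n%:R z.
  by rewrite !clip_ge ?mulrSr ?lerD2r//; lra.
have [z0|z0] := lerP 0 z.
  rewrite (clip_id (n := n)) ?z0 ?ltW// clip_ge; last by lra.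
  by rewrite clip_id//; apply/andP; split; [lra|rewrite mulrSr; lra].
rewrite (@clip_le0 _ n) ?ltW// add0r.
have [z1|z1] := lerP 0 (z + 1); last by rewrite !clip_le0 ?ltW.
by rewrite !clip_id//; apply/andP; split=> //; [rewrite mulrSr; lra|lra].
Qed.

Lemma clip_scale (R : realType) (k : nat) (x : R) : (0 < k)%N ->
  k%:R^-1 * clip k (k%:R - k%:R * x) = clip 1 (1 - x).
Proof.
rewrite -(ltr0n R) => k0; have ki : 0 <= k%:R^-1 :> R by rewrite invr_ge0 ltW.
rewrite /clip maxr_pMr// minr_pMr// mulr0 mulVf ?gt_eqF// mulrBr mulrA.
by rewrite mulVf ?gt_eqF// mul1r.
Qed.

Lemma uniform_prob01_tail (R : realType) (x : R) :
  uniform_prob (@ltr01 R) `]x, +oo[ = (clip 1 (1 - x))%:E.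
Proof.
rewrite uniform_prob01E// /clip.
have [x0|x0] := ltP x 0.
  rewrite setIidr => [|y /=]; last by rewrite !in_itv /= andbT => /andP[/(lt_le_trans x0)].
  rewrite lebesgue_measure_itv /= lte_fin ltr01 oppr0 adde0.
  by rewrite min_l ?max_r//; lra.
rewrite (_ : _ `&` _ = `]x, 1]%classic); last first.
  apply/seteqP; split => y /=; rewrite !in_itv /= ?andbT.
    by case=> -> /andP[].
  by case/andP=> xy ->; rewrite xy (le_trans x0 (ltW xy)).
rewrite lebesgue_measure_itv /= lte_fin; case: ltP => x1.
  by rewrite min_r ?max_r//; lra.
by rewrite min_r ?max_l//; lra.
Qed.

(** Open upper rays are stable under intersection, generate the Borel sets and exhaust the line, so
    they determine the law. *)
Lemma is_uniform01P d (T : measurableType d) (R : realType) (P : probability T R)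
    (X : {RV P >-> R}) :
  is_uniform01 X <-> forall x, P (X @^-1` `]x, +oo[) = (clip 1 (1 - x))%:E.
Proof.
split=> [uX x|tX].
  by rewrite -uniform_prob01_tail; exact: uX.
move=> A mA.
have mid : measurable_fun [set: measurableTypeR R] (idfun : measurableTypeR R -> R).
  exact: measurable_id.
(* Moves [uniform_prob] to the canonical Borel structure of [R]. *)
apply: (@measure_unique _ R _ (@RGenOInfty.G R) (fun n => `]- n%:R, +oo[%classic)
  _ _ _ _ (distribution P X)
  (pushforward (uniform_prob (@ltr01 R)) (idfun : measurableTypeR R -> R))) => //.
- exact: RGenOInfty.measurableE.
- move=> _ _ [x ->] [y ->]; exists (Num.max x y); apply/seteqP.
  by split => z /=; rewrite !in_itv /= !andbT gt_max => /andP.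
- by move=> n; exists (- n%:R).
- apply/seteqP; split => // x _; exists (Num.truncn `|x|).+1 => //=.
  rewrite in_itv /= andbT ltrNl (le_lt_trans _ (truncnS_gt _))//.
  by rewrite -normrN ler_norm.
- move=> _ [x ->]; exact: etrans (tX x) (esym (uniform_prob01_tail x)).
- by move=> n; rewrite (le_lt_trans (probability_le1 _ _)) ?ltry.
Qed.

(** By transposition the sum is the same for every position, and summing over positions runs through
    all values for each [p]. *)
Lemma sum_perm_value (V : zmodType) (k : nat) (phi : 'I_k -> V) (i : 'I_k) :
  (\sum_(p : 'S_k) phi (p i)) *+ k = (\sum_j phi j) *+ k`!.
Proof.
have swapE i' : \sum_(p : 'S_k) phi (p i) = \sum_(p : 'S_k) phi (p i').
  rewrite (reindex_inj (mulgI (tperm i i'))) /=.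
  by apply: eq_bigr => p _; rewrite permM tpermL.
transitivity (\sum_(i' < k) \sum_(p : 'S_k) phi (p i')).
  by rewrite -(eq_bigr _ (fun i' _ => swapE i')) sumr_const card_ord.
rewrite exchange_big /=; transitivity (\sum_(p : 'S_k) \sum_j phi j).
  by apply: eq_bigr => p _; rewrite [RHS](reindex_inj (@perm_inj _ p)).
by rewrite sumr_const card_Sn.
Qed.

Section sampling_marginals.
Context d (T : measurableType d) (R : realType) (P : probability T R).
Variables (k : nat) (U : nat -> 'I_k -> {RV P >-> R}) (sigma : nat -> T -> 'S_k).
Hypothesis hU : iterative_LHS U sigma.

Lemma probability_perm_split t (A : set T) : measurable A ->
  (P A = \sum_(p : 'S_k) P (sigma t @^-1` [set p] `&` A))%E.
Proof.
move=> mA; rewrite -probability_bigsetU.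
- congr (P _); apply/seteqP; split => [w Aw|w].
    by rewrite -bigcup_seq; exists (sigma t w); rewrite //= mem_index_enum.
  by rewrite -bigcup_seq => -[p _ []].
- by move=> p; apply: measurableI => //; exact: (lhs_perm_measurable hU).
- by move=> p p' _ _ [w [[/= <- _] [/= <- _]]].
Qed.

(** Given [sigma t = p], the new point exceeds [x] exactly when the old one exceeds
    [k%:R * x - (p i)%:R]. Averaging these tails over the equally likely values [p i] rebuilds the
    tail at [x], by [sum_clip] and [clip_scale]. *)
Lemma lhs_uniform t i : is_uniform01 (U t i).
Proof.
elim: t i => [|t IHt] i; first exact: (lhs_init_uniform hU).
have k0 : (0 < k)%N by case: k i => [[]|].
have k0R : 0 < k%:R :> R by rewrite ltr0n.
apply/is_uniform01P => x; rewrite (probability_perm_split t); last first.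
  exact: measurable_funPTI.
rewrite (eq_bigr (fun p : 'S_k => (k`!%:R^-1 * clip 1 (1 - k%:R * x + (p i)%:R))%:E)).
  rewrite sumEFin -mulr_sumr; congr EFin.
  rewrite -(clip_scale x k0) -sum_clip; set S := \sum_p _; set C := \sum_(j < k) _.
  have SE : S * k%:R = C * k`!%:R.
    by rewrite !mulr_natr; exact: (sum_perm_value (fun j : 'I_k => clip 1 (1 - k%:R * x + j%:R))).
  have f0 : k`!%:R != 0 :> R by rewrite pnatr_eq0 -lt0n fact_gt0.
  have -> : S = C * k`!%:R / k%:R by rewrite -SE mulfK ?gt_eqF.
  by field; rewrite f0 gt_eqF.
move=> p _.
rewrite (_ : _ `&` _ = sigma t @^-1` [set p] `&`
    U t i @^-1` `](k%:R * x - (p i)%:R), +oo[); last first.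
  apply/seteqP; split => w /= [<-]; rewrite (lhs_step hU) !in_itv /= !andbT.
    by rewrite mulrC ltr_pdivlMr// mulrC ltrBlDl.
  by move=> h; rewrite mulrC ltr_pdivlMr// mulrC -ltrBlDl.
rewrite (lhs_perm_independent hU); last by apply: (draws_path hU).
rewrite (lhs_perm_uniform hU) (is_uniform01P (U t i)).1// EFinM.
by congr (_ * (clip 1 _)%:E)%E; rewrite opprB addrA addrAC.
Qed.

End sampling_marginals.

(** * Moments *)

Lemma sum_natr (R : realType) (n : nat) :
  \sum_(j < n) j%:R = n%:R * (n%:R - 1) / 2 :> R.
Proof.
elim: n => [|n IHn]; first by rewrite big_ord0 !mul0r.
by rewrite big_ord_recr /= IHn mulrSr; field.
Qed.

Lemma sum_natr_sqr (R : realType) (n : nat) :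
  \sum_(j < n) j%:R * j%:R = n%:R * (n%:R - 1) * (2 * n%:R - 1) / 6 :> R.
Proof.
elim: n => [|n IHn]; first by rewrite big_ord0 !mul0r.
by rewrite big_ord_recr /= IHn mulrSr; field.
Qed.

Lemma mean_perm_value (R : realType) (k : nat) (phi : 'I_k -> R) (i : 'I_k) :
  k`!%:R^-1 * \sum_(p : 'S_k) phi (p i) = k%:R^-1 * \sum_j phi j.
Proof.
have k0 : k%:R != 0 :> R by rewrite pnatr_eq0; case: k i {phi} => [[]|].
have f0 : k`!%:R != 0 :> R by rewrite pnatr_eq0 -lt0n fact_gt0.
set S := \sum_p _; set C := \sum_j _.
have SE : S * k%:R = C * k`!%:R by rewrite !mulr_natr; exact: sum_perm_value.
have -> : S = C * k`!%:R / k%:R by rewrite -SE mulfK.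
by field; rewrite f0 k0.
Qed.

(** The sum [S j'] is the same for all [j' != i], and the entries of a permutation add up to
    [k (k - 1) / 2]. Summing over [j'] thus expresses [(k - 1) * S j] by the first moment and
    [S i]. *)
Lemma mean_perm_product (R : realType) (k : nat) (i j : 'I_k) : i != j ->
  k`!%:R^-1 * (\sum_(p : 'S_k) (p i)%:R * (p j)%:R) =
  (3 * k%:R - 1) * (k%:R - 2) / 12 :> R.
Proof.
move=> ij; have k1 : (1 < k)%N.
  by case: k i j ij => [[]|[|k]] // i j; rewrite !ord1 eqxx.
pose S j' : R := \sum_(p : 'S_k) (p i)%:R * (p j')%:R.
have SE j' : j' != i -> S j' = S j.
  move=> j'i; rewrite /S (reindex_inj (mulgI (tperm j j'))) /=.
  by apply: eq_bigr => p _; rewrite !permM tpermR tpermD// eq_sym.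
have sumS : \sum_j' S j' = (k%:R * (k%:R - 1) / 2) * \sum_(p : 'S_k) (p i)%:R.
  rewrite exchange_big mulr_sumr; apply: eq_bigr => p _ /=.
  by rewrite -mulr_sumr mulrC -sum_natr [X in _ = X * _](reindex_inj (@perm_inj _ p)).
have := sumS; rewrite (bigD1 i)//= (eq_bigr _ SE) sumr_const.
rewrite (_ : #|_| = k.-1)%N; last first.
  by rewrite cardC1 card_ord.
rewrite -[S j *+ _]mulr_natr -subn1 natrB ?(ltnW k1)// => SSE.
have := mean_perm_value (fun j : 'I_k => j%:R * j%:R : R) i.
rewrite -/(S i) sum_natr_sqr.
have := mean_perm_value (fun j : 'I_k => j%:R : R) i.
rewrite sum_natr -/(S j) => meanE sqrE.
have kn1 : k%:R - 1 != 0 :> R by rewrite subr_eq0 (eqr_nat R k 1) gtn_eqF.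
have k0 : k%:R != 0 :> R by rewrite pnatr_eq0 -lt0n ltnW.
apply: (mulIf kn1).
have -> : k`!%:R^-1 * S j * (k%:R - 1) = k%:R * (k%:R - 1) / 2 *
    (k`!%:R^-1 * \sum_(p : 'S_k) (p i)%:R) - k`!%:R^-1 * S i.
  by rewrite mulrCA -SSE; ring.
by rewrite meanE sqrE; field.
Qed.


Section sampling_moments.
Context d (T : measurableType d) (R : realType) (P : probability T R).
Variables (k : nat) (U : nat -> 'I_k -> {RV P >-> R}) (sigma : nat -> T -> 'S_k).
Hypothesis hU : iterative_LHS U sigma.
Hypothesis k_gt1 : (1 < k)%N.

Let perm_value t i : T -> R := fun w => (nat_of_ord (sigma t w i))%:R.

Lemma perm_independent t (B : set 'S_k) (A : set T) :
  previous_draws (U 0%N) sigma t A ->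
  P (sigma t @^-1` B `&` A) = (P (sigma t @^-1` B) * P A)%E.
Proof.
move=> dA; have mA : measurable A := draws_measurable hU dA.
have split_term p A' : previous_draws (U 0%N) sigma t A' ->
    P (sigma t @^-1` [set p] `&` (sigma t @^-1` B `&` A')) =
    ((k`!%:R^-1 * (p \in B)%:R)%:E * P A')%E.
  move=> dA'; have [pB|pB] := pselect (B p).
    rewrite (mem_set pB) mulr1 (_ : _ `&` _ = sigma t @^-1` [set p] `&` A').
      by rewrite (lhs_perm_independent hU)// (lhs_perm_uniform hU).
    apply/seteqP; split => w; first by case=> h [].
    by case=> /= h A'w; rewrite h.
  rewrite (memNset pB) mulr0 mul0e (_ : _ `&` _ = set0) ?measure0//.
  by apply/seteqP; split => w //= -[->] [].
have mB := measurable_perm hU t B.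
have sumE A' : previous_draws (U 0%N) sigma t A' ->
    (P (sigma t @^-1` B `&` A') = (\sum_(p : 'S_k) k`!%:R^-1 * (p \in B)%:R)%:E * P A')%E.
  move=> dA'; rewrite (probability_perm_split hU t); last first.
    by apply: measurableI => //; exact: draws_measurable hU _ _ dA'.
  rewrite (eq_bigr _ (fun p _ => split_term p _ dA')).
  rewrite -(fineK (fin_num_measure P _ (draws_measurable hU dA'))).
  by under eq_bigr do rewrite -EFinM; rewrite sumEFin -EFinM mulr_suml.
rewrite sumE// -[sigma t @^-1` B]setIT sumE ?[P setT]probability_setT ?mule1//.
exact: (@measurableT _ (g_sigma_algebraType _)).
Qed.

Lemma measurable_perm_value t i : measurable_fun setT (perm_value t i).
Proof.
move=> _ B mB; rewrite setTI.
rewrite (_ : _ @^-1` _ = sigma t @^-1` [set p | B (nat_of_ord (p i))%:R])//.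
exact: (measurable_perm hU).
Qed.

(** The events [sigma t = p] have equal mass and the integrand is constant on each, so the upper and
    lower partition bounds coincide. *)
Lemma expectation_perm_fun t (phi : 'S_k -> R) : (forall p, 0 <= phi p) ->
  'E_P[fun w => phi (sigma t w)]%E = (k`!%:R^-1 * \sum_p phi p)%:E.
Proof.
move=> phi0; rewrite unlock.
have mphi : measurable_fun setT (fun w => phi (sigma t w)).
  move=> _ B mB; rewrite setTI.
  by rewrite -[X in measurable X]/(sigma t @^-1` (phi @^-1` B)); exact: (measurable_perm hU).
have mE p : measurable (sigma t @^-1` [set p]) := lhs_perm_measurable hU t p.
have tE : trivIset setT (fun p => sigma t @^-1` [set p]).
  by move=> p p' _ _ [w [/= <- <-]].
have PE := lhs_perm_uniform hU t.
have cE : #|{: 'S_k}|%:R * k`!%:R^-1 = 1 :> R.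
  by rewrite card_Sn divff// pnatr_eq0 -lt0n fact_gt0.
apply/eqP; rewrite eq_le; apply/andP; split.
  by apply: (integral_partition_le mE tE PE cE) => // p w /= ->.
by apply: (integral_partition_ge mE tE PE cE) => // p w /= ->.
Qed.

Lemma lhs_ae01 t i : {ae P, forall w, 0 <= U t i w <= 1}.
Proof.
have mA : measurable (U t i @^-1` `[0, 1]) by exact: measurable_funPTI.
exists (~` (U t i @^-1` `[0, 1])); split; first exact: measurableC.
  rewrite [LHS]probability_setC// [X in (_ - X)%E](lhs_uniform hU)//.
  rewrite uniform_prob01E// setIid lebesgue_measure_itv /= lte_fin ltr01.
  by rewrite oppr0 adde0 subee.
by move=> w /= ww; rewrite in_itv.
Qed.

Lemma lhs_Lfun1 t i : (U t i : T -> R) \in Lfun P 1.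
Proof.
apply: (@bounded_Lfun1 _ _ _ _ _ 1) => //.
by apply: filterS (lhs_ae01 t i) => w /andP[? ?]; rewrite ger0_norm.
Qed.

Lemma lhs_mul_Lfun1 t i j : ((U t i : T -> R) * (U t j : T -> R))%R \in Lfun P 1.
Proof.
apply: (@bounded_Lfun1 _ _ _ _ _ 1) => //.
apply: filterS2 (lhs_ae01 t i) (lhs_ae01 t j) => w /andP[? ?] /andP[? ?].
by rewrite ger0_norm ?mulr_ge0// mulr_ile1.
Qed.

Lemma perm_value_le t i w : `|perm_value t i w| <= k%:R.
Proof. by rewrite normr_nat ler_nat ltnW. Qed.

Lemma perm_value_Lfun1 t i : perm_value t i \in Lfun P 1.
Proof.
apply: (bounded_Lfun1 (measurable_perm_value t i)).
by apply: aeW => w; exact: perm_value_le.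
Qed.

Lemma expectation_perm_value t i : 'E_P[perm_value t i]%E = ((k%:R - 1) / 2)%:E.
Proof.
have k0 : k%:R != 0 :> R by rewrite pnatr_eq0 -lt0n ltnW.
rewrite (@expectation_perm_fun t (fun p => (nat_of_ord (p i))%:R))//.
congr EFin; rewrite (mean_perm_value (fun j : 'I_k => j%:R)) sum_natr.
by field.
Qed.

Lemma expectation_perm_value_lhs t i j :
  ('E_P[(perm_value t i * (U t j : T -> R))%R] = ((k%:R - 1) / 2)%:E * 'E_P[U t j])%E.
Proof.
rewrite -(expectation_perm_value t i); apply: expectation_mul_indep => //.
- exact: measurable_perm_value.
- by apply: aeW => w; exact: ler0n.
- by apply: filterS (lhs_ae01 t j) => w /andP[].
- move=> A B mA mB.
  exact: (perm_independent [set p : 'S_k | A (nat_of_ord (p i))%:R] (draws_path hU j mB)).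
Qed.

Let m1 t i : R := fine 'E_P[U t i]%E.
Let m2 t i j : R := fine 'E_P[((U t i : T -> R) * (U t j : T -> R))%R]%E.

Lemma lhs_mean_step t i : m1 t.+1 i = k%:R^-1 * ((k%:R - 1) / 2 + m1 t i).
Proof.
have -> : m1 t.+1 i = fine 'E_P[(k%:R^-1 \o* (perm_value t i \+ U t i))%R]%E.
  congr (fine 'E_P[_]); apply/funext => w; rewrite (lhs_step hU) mulrC//.
rewrite expectationZl; last by rewrite rpredD ?perm_value_Lfun1 ?lhs_Lfun1.
rewrite expectationD ?perm_value_Lfun1 ?lhs_Lfun1//.
by rewrite expectation_perm_value -(fineK (expectation_fin_num (lhs_Lfun1 t i))).
Qed.

(** Expansion of the product of two one-step recursions, with mixed terms factored by independence.
    The case [i = j] is included and serves for the variance. *)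
Lemma lhs_second_moment_step t i j :
  m2 t.+1 i j = k%:R ^- 2 * (k`!%:R^-1 * (\sum_(p : 'S_k) (p i)%:R * (p j)%:R)
    + (k%:R - 1) / 2 * m1 t j + (k%:R - 1) / 2 * m1 t i + m2 t i j).
Proof.
have Lp : (perm_value t i * perm_value t j)%R \in Lfun P 1.
  apply: (@bounded_Lfun1 _ _ _ _ _ (k%:R * k%:R)).
    by apply: measurable_funM; exact: measurable_perm_value.
  by apply: aeW => w; rewrite normrM ler_pM// perm_value_le.
have LpU a b : (perm_value t a * (U t b : T -> R))%R \in Lfun P 1.
  apply: (@bounded_Lfun1 _ _ _ _ _ (k%:R * 1)).
    by apply: measurable_funM => //; exact: measurable_perm_value.
  apply: filterS (lhs_ae01 t b) => w /andP[U0 U1].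
  by rewrite normrM ler_pM ?perm_value_le ?ger0_norm.
have -> : m2 t.+1 i j = fine 'E_P[(k%:R ^- 2 \o* ((perm_value t i * perm_value t j)%R \+
    ((perm_value t i * (U t j : T -> R))%R \+ ((perm_value t j * (U t i : T -> R))%R \+
      ((U t i : T -> R) * (U t j : T -> R))%R))))%R]%E.
  congr (fine 'E_P[_]); apply/funext => w.
  transitivity (U t.+1 i w * U t.+1 j w) => //; rewrite !(lhs_step hU).
  transitivity ((perm_value t i w * perm_value t j w + (perm_value t i w * U t j w +
    (perm_value t j w * U t i w + U t i w * U t j w))) * k%:R ^- 2) => //.
  by rewrite /perm_value -exprVn; ring.
rewrite expectationZl ?rpredD ?lhs_mul_Lfun1// !expectationD ?rpredD ?lhs_mul_Lfun1//.
rewrite (@expectation_perm_fun t (fun p => (nat_of_ord (p i))%:R * (nat_of_ord (p j))%:R))//.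
rewrite !expectation_perm_value_lhs.
rewrite -(fineK (expectation_fin_num (lhs_Lfun1 t i))) -(fineK (expectation_fin_num (lhs_Lfun1 t j))).
rewrite -(fineK (expectation_fin_num (lhs_mul_Lfun1 t i j))) -/(m1 t i) -/(m1 t j) -/(m2 t i j).
by rewrite -!(EFinM, EFinD) /=; ring.
Qed.

Lemma lhs_same_law t i (f : R -> R) : measurable_fun setT f ->
  P.-integrable setT (EFin \o (f \o U t.+1 i)) ->
  P.-integrable setT (EFin \o (f \o U t i)) ->
  ('E_P[f \o U t.+1 i] = 'E_P[f \o U t i])%E.
Proof.
move=> mf i1 i2; have mfE : measurable_fun setT (EFin \o f) by exact/measurable_EFinP.
rewrite unlock -(integral_distribution mfE i1) -(integral_distribution mfE i2).
apply: eq_measure_integral => A mA _.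
by rewrite [LHS](lhs_uniform hU)// [RHS](lhs_uniform hU).
Qed.

(* The marginal law does not depend on t, so the one-step recursion for the mean
   is an equation that determines it. *)
Lemma lhs_mean t i : m1 t i = 1 / 2.
Proof.
have k1 : k%:R - 1 != 0 :> R by rewrite subr_eq0 (eqr_nat R k 1) gtn_eqF.
have k0 : k%:R != 0 :> R by rewrite pnatr_eq0 -lt0n ltnW.
have := lhs_mean_step t i; have -> : m1 t.+1 i = m1 t i.
  by congr fine; apply: (@lhs_same_law t i id) => //; apply/Lfun1_integrable; exact: lhs_Lfun1.
move=> mE; apply: (mulIf k1).
have : k%:R * m1 t i = (k%:R - 1) / 2 + m1 t i by rewrite {1}mE mulrA divff// mul1r.
lra.
Qed.

Lemma lhs_second_moment t i : m2 t i i = 1 / 3.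
Proof.
have k1 : k%:R - 1 != 0 :> R by rewrite subr_eq0 (eqr_nat R k 1) gtn_eqF.
have k0 : k%:R != 0 :> R by rewrite pnatr_eq0 -lt0n ltnW.
have kp1 : k%:R + 1 != 0 :> R by rewrite natr1 pnatr_eq0.
have := lhs_second_moment_step t i i; have -> : m2 t.+1 i i = m2 t i i.
  congr fine; apply: (@lhs_same_law t i (fun x => x * x)) => //.
  - exact: measurable_funM.
  - by apply/Lfun1_integrable; exact: lhs_mul_Lfun1.
  - by apply/Lfun1_integrable; exact: lhs_mul_Lfun1.
rewrite (mean_perm_value (fun j : 'I_k => j%:R * j%:R)) sum_natr_sqr !lhs_mean.
set x := m2 t i i => xE.
have {}xE : k%:R ^+ 2 * x = (k%:R - 1) * (2 * k%:R - 1) / 6 + (k%:R - 1) / 2 + x.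
  by rewrite {1}xE; field.
(* The equation determines [(k ^ 2 - 1) * x], and [k ^ 2 - 1] factors into these two nonzero
   terms. *)
apply: (mulIf k1); apply: (mulIf kp1).
have -> : x * (k%:R - 1) * (k%:R + 1) = k%:R ^+ 2 * x - x by ring.
by rewrite xE; field.
Qed.

Lemma lhs_init_product i j : i != j -> m2 0%N i j = 1 / 4.
Proof.
move=> ij; rewrite /m2 expectation_mul_indep//.
- rewrite -(fineK (expectation_fin_num (lhs_Lfun1 0%N i))).
  rewrite -(fineK (expectation_fin_num (lhs_Lfun1 0%N j))).
  by rewrite -/(m1 _ _) -/(m1 _ _) !lhs_mean -EFinM /=; field.
- by apply: filterS (lhs_ae01 0%N i) => w /andP[].
- by apply: filterS (lhs_ae01 0%N j) => w /andP[].
move=> A B mA mB.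
(* Mutual independence is applied to the pair of indices [i], [j], which needs one family of
   sets. *)
pose C l := if l == i then A else B.
have mC l : measurable (C l) by rewrite /C; case: ifP.
have := lhs_init_independent hU [set i; j]%SET mC.
rewrite big_setU1 ?inE//= big_set1 {2 3}/C eqxx eq_sym (negbTE ij) => <-.
congr (P _); apply/seteqP; split => w /=.
  move=> [wA wB] l; rewrite /= !inE => /orP[/eqP ->|/eqP ->]; rewrite /C ?eqxx//.
  by rewrite eq_sym (negbTE ij).
move=> h; split; first by have := h i; rewrite /C eqxx; apply; rewrite /= !inE eqxx.
by have := h j; rewrite /C eq_sym (negbTE ij); apply; rewrite /= !inE eqxx orbT.
Qed.

(** The recursion is affine with ratio [k ^ -2] and fixed point [1 / 4 - 1 / (12 (k - 1))], started
    at the independent value [1 / 4]. *)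
Lemma lhs_product_moment t i j : i != j ->
  m2 t i j = 1 / 4 - (1 - k%:R ^- (2 * t)) / (12 * (k%:R - 1)).
Proof.
move=> ij; have k1 : k%:R - 1 != 0 :> R by rewrite subr_eq0 (eqr_nat R k 1) gtn_eqF.
have k0 : k%:R != 0 :> R by rewrite pnatr_eq0 -lt0n ltnW.
elim: t => [|t IHt]; first by rewrite lhs_init_product// muln0 expr0 invr1 subrr mul0r subr0.
rewrite lhs_second_moment_step IHt mean_perm_product// !lhs_mean mulnS exprD invfM.
have kt0 : k%:R ^+ (2 * t) != 0 :> R by rewrite expf_neq0.
by field; rewrite kt0 k1 k0.
Qed.

Lemma lhs_correlation t i j : i != j ->
  correlation P (U t i) (U t j) = - (k%:R - 1)^-1 * (1 - (k%:R ^+ (2 * t))^-1).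
Proof.
move=> ij; have k1 : k%:R - 1 != 0 :> R by rewrite subr_eq0 (eqr_nat R k 1) gtn_eqF.
(* Taking [a = b] gives the variance [1 / 3 - 1 / 4 = 1 / 12], which cancels the 12 in the product
   moment. *)
have covE a b : fine (covariance P (U t a) (U t b)) = m2 t a b - 1 / 4.
  rewrite covarianceE ?lhs_Lfun1 ?lhs_mul_Lfun1//.
  rewrite -(fineK (expectation_fin_num (lhs_mul_Lfun1 t a b))).
  rewrite -(fineK (expectation_fin_num (lhs_Lfun1 t a))).
  rewrite -(fineK (expectation_fin_num (lhs_Lfun1 t b))).
  by rewrite -/(m1 _ _) -/(m1 _ _) -/(m2 _ _ _) !lhs_mean -EFinM -EFinB /=; field.
rewrite /correlation /variance !covE !lhs_second_moment lhs_product_moment//.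
rewrite -expr2 sqr_sqrtr; last by lra.
have kt0 : k%:R ^+ (2 * t) != 0 :> R.
  by rewrite expf_neq0// pnatr_eq0 -lt0n ltnW.
by field; rewrite kt0 k1.
Qed.

End sampling_moments.

Theorem theorem4 (d : measure_display) (T : measurableType d) (R : realType)
    (P : probability T R) (k : nat) (hk : (2 <= k)%N)
    (U : nat -> 'I_k -> {RV P >-> R}) (sigma : nat -> T -> 'S_k)
    (hU : iterative_LHS U sigma) :
  [/\ forall (t : nat) (i : 'I_k), is_uniform01 (U t i),
      forall (t : nat) (i j : 'I_k), i <> j ->
        correlation P (U t i) (U t j)
        = - (k%:R - 1)^-1 * (1 - (k%:R ^+ (2 * t))^-1)
    & forall t : 'I_k -> nat,
        negatively_associated P (fun i : 'I_k => U (t i) i) ].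
Proof.
split=> [t i|t i j /eqP ij|t].
- exact: (lhs_uniform hU).
- exact: (lhs_correlation hU hk).
- exact: (lhs_negatively_associated hU).
Qed.
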